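(* Let $\alpha$ be a cyclotomic integer with $l(\alpha)=2$. Then $$[\mathbb{Q}_{c(\alpha)}:\mathbb{Q}(\alpha)] \leq l(\alpha) = 2.$$
   Context: For a positive integer $n$, $\mathbb{Q}_n$ denotes the extension of $\mathbb{Q}$ generated by a primitive $n$th root of unity in $\mathbb{C}$. A cyclotomic integer is an algebraic integer that can be expressed as a sum of complex roots of unity (repetitions allowed). A representation $\alpha=\sum_{i=1}^k \epsilon_i$ with each $\epsilon_i$ a root of unity has weight $k$. The length $l(\alpha)$ of a cyclotomic integer $\alpha$ is the smallest weight among all representations of $\alpha$ as a sum of roots of unity. The conductor $c(\alpha)$ is the smallest positive integer such that $\mathbb{Q}(\alpha)\subseteq\mathbb{Q}_{c(\alpha)}$. *)

(* Defs.v *)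
(* C is represented by algC, the field of complex algebraic numbers. *)
From HB Require Import structures.
From mathcomp Require Import all_boot all_order all_algebra all_field.

Set Implicit Arguments.
Unset Strict Implicit.
Unset Printing Implicit Defensive.

Import Order.TTheory GRing.Theory Num.Theory.
Local Open Scope ring_scope.

(* The bound 0 < n matters: every z satisfies 0.-unity_root z. *)
Definition root_of_unity (z : algC) : Prop :=
  exists2 n : nat, (0 < n)%N & n.-unity_root z.

Definition has_repr_of_weight (alpha : algC) (k : nat) : Prop :=
  exists2 eps : 'I_k -> algC,
    forall i, root_of_unity (eps i) & alpha = \sum_(i < k) eps i.

Definition cyclotomic_integer (alpha : algC) : Prop :=
  alpha \in Aint /\ exists k : nat, has_repr_of_weight alpha k.

Definition is_smallest (P : nat -> Prop) (n : nat) : Prop :=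
  P n /\ forall m : nat, P m -> (n <= m)%N.

(* The empty sum is a representation of weight 0, so 0 has length 0. *)
Definition has_length (alpha : algC) (k : nat) : Prop :=
  is_smallest (has_repr_of_weight alpha) k.

(* num_field_exists provides, for s : seq algC, a number field with an
   embedding in algC under which it is generated over rat by a list of
   preimages of s; its image in algC is Q(s). *)
Definition Qadj (s : seq algC) : fieldExtType rat := tag (num_field_exists s).

Definition Qadj_emb (s : seq algC) : {rmorphism Qadj s -> algC} :=
  tag (tagged (num_field_exists s)).

Lemma Qadj_gen (s : seq algC) :
  exists2 s1 : seq (Qadj s),
    map (Qadj_emb s) s1 = s & <<1 & s1>>%VS = fullv.
Proof.
by rewrite /Qadj_emb /Qadj; case: num_field_exists => Qs [QsC [s1 H1 H2]] /=;
   exists s1.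
Qed.

Definition in_Qadj (s : seq algC) (x : algC) : Prop :=
  exists y : Qadj s, Qadj_emb s y = x.

(* C_prim_root_exists needs a proof that the order is positive; n.-1.+1 is n
   as soon as 0 < n. *)
Definition zeta (n : nat) : algC := sval (C_prim_root_exists (ltn0Sn n.-1)).

Lemma zeta_prim (n : nat) : (0 < n)%N -> n.-primitive_root (zeta n).
Proof.
by move=> n_gt0; move: (svalP (C_prim_root_exists (ltn0Sn n.-1)));
   rewrite -/(zeta n) prednK.
Qed.

Definition Qcyc (n : nat) : fieldExtType rat := Qadj [:: zeta n].

Definition Qcyc_emb (n : nat) : {rmorphism Qcyc n -> algC} :=
  Qadj_emb [:: zeta n].

Definition has_conductor (alpha : algC) (c : nat) : Prop :=
  is_smallest (fun n => (0 < n)%N /\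
    forall x : algC, in_Qadj [:: alpha] x -> in_Qadj [:: zeta n] x) c.

(* Main.v *)
(* Write alpha = e1 + e2 with orders n1, n2 and m = lcm(n1, n2).  Conjugation
   shows that a nonzero sum of two roots of unity determines the unordered pair
   of its terms, so an automorphism fixing alpha fixes or swaps e1 and e2, and
   its restriction to Q_m is determined by which of the two it does.  Since
   Q_c and Q_m meet in Q_gcd(c, m), minimality of the conductor gives c | m,
   hence Q_c is contained in Q_m and Gal(Q_c / Q(alpha)) has at most two
   elements. *)
Require Import Defs.
From HB Require Import structures.
From mathcomp Require Import all_boot all_order all_algebra all_field.
From mathcomp Require Import ring.

Set Implicit Arguments.
Unset Strict Implicit.
Unset Printing Implicit Defensive.

Import Order.TTheory GRing.Theory Num.Theory.
Local Open Scope ring_scope.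

(** * Roots of unity and sums of two of them *)

(* Unqualified, root_of_unity is the MathComp predicate of the same name. *)
Lemma root_of_unity_conj (z : algC) : Defs.root_of_unity z -> z^* = z^-1.
Proof.
case=> n n_gt0 /unity_rootP zn1; rewrite invC_norm.
have /eqP -> : `|z| == 1 by rewrite -(pexpr_eq1 n_gt0) // -normrX zn1 normr1.
by rewrite expr1n invr1 mul1r.
Qed.

(* Conjugation sends x + y to (x + y) / (x y), so the sum, being nonzero,
   determines the product x y. *)
Lemma root_of_unity_sum_inj (x y x' y' : algC) :
    Defs.root_of_unity x -> Defs.root_of_unity y ->
    Defs.root_of_unity x' -> Defs.root_of_unity y' ->
    x + y != 0 -> x' + y' = x + y ->
  (x' = x /\ y' = y) \/ (x' = y /\ y' = x).
Proof.
move=> Ux Uy Ux' Uy' nz_s eq_s.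
have nz z : Defs.root_of_unity z -> z != 0.
  case=> n n_gt0 /unity_rootP zn1; apply: contra_eq_neq zn1 => ->.
  by rewrite expr0n eqn0Ngt n_gt0 eq_sym oner_eq0.
have conj_s u v : Defs.root_of_unity u -> Defs.root_of_unity v ->
    (u + v)^* = (u + v) / (u * v).
  move=> Uu Uv; rewrite rmorphD /= !root_of_unity_conj //.
  rewrite invfM mulrDl mulrA mulfV ?nz // mul1r [u^-1 * _]mulrC mulrA.
  by rewrite mulfV ?nz // mul1r addrC.
have eq_p : x' * y' = x * y.
  have := conj_s _ _ Ux' Uy'; rewrite eq_s conj_s //.
  by move/(mulfI nz_s)/invr_inj.
(* With equal sums and products, x' is a root of (T - x)(T - y). *)
have /eqP : (x' - x) * (x' - y) = 0.
  have -> : (x' - x) * (x' - y)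
      = x' * ((x' + y') - (x + y)) - (x' * y' - x * y) by ring.
  by rewrite eq_s eq_p !subrr mulr0 subr0.
rewrite mulf_eq0 !subr_eq0 => /orP[] /eqP Dx'; [left | right]; split=> //.
  by apply: (addrI x); rewrite -eq_s Dx'.
by apply: (addrI y); rewrite [y + x]addrC -eq_s Dx'.
Qed.

(** One exponent serves all n-th roots of unity, as they are powers of a single primitive one. *)
Lemma algC_aut_expr (n : nat) (nu : {rmorphism algC -> algC}) :
  (0 < n)%N ->
  exists2 k, coprime k n & forall z : algC, z ^+ n = 1 -> nu z = z ^+ k.
Proof.
move=> n_gt0; have [z prim_z] := C_prim_root_exists n_gt0.
have [k co_k nu_z] := aut_prim_rootP nu prim_z.
exists k => // _ /(prim_rootP prim_z)[i ->].
by rewrite rmorphXn /= nu_z exprAC.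
Qed.

(** * Fields generated by one algebraic number *)

Lemma Qadj1_gen (z : algC) :
  exists2 x : Qadj [:: z], Qadj_emb [:: z] x = z & <<1; x>>%VS = fullv.
Proof.
have [[|x []] //= [Dx] genx] := Qadj_gen [:: z].
by exists x => //; rewrite -genx adjoin_seq1.
Qed.

Lemma rmorph_horner_rat (F : fieldExtType rat) (f : {rmorphism F -> algC})
    (p : {poly rat}) (x : F) :
  f (map_poly (in_alg F) p).[x] = (map_poly ratr p).[f x].
Proof.
rewrite -horner_map -map_poly_comp; congr _.[_]; apply: eq_map_poly => a /=.
by rewrite alg_num_field fmorph_rat.
Qed.

Lemma in_Qadj1P (z x : algC) :
  in_Qadj [:: z] x <-> exists p : {poly rat}, x = (map_poly ratr p).[z].
Proof.
have [w Dw genw] := Qadj1_gen z; split=> [[y <-] | [p ->]].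
  have /Fadjoin1_polyP[p ->] : y \in <<1; w>>%VS by rewrite genw memvf.
  by exists p; rewrite rmorph_horner_rat Dw.
by exists (map_poly (in_alg _) p).[w]; rewrite rmorph_horner_rat Dw.
Qed.

Lemma in_Qadj1_trans (x y z : algC) :
  in_Qadj [:: z] y -> in_Qadj [:: y] x -> in_Qadj [:: z] x.
Proof.
move=> /in_Qadj1P[p ->] /in_Qadj1P[q ->]; apply/in_Qadj1P.
by exists (q \Po p); rewrite map_comp_poly horner_comp.
Qed.

Lemma in_Qadj1_id (z : algC) : in_Qadj [:: z] z.
Proof. by apply/in_Qadj1P; exists 'X; rewrite map_polyX hornerX. Qed.

Lemma in_Qadj1_fix (nu : {rmorphism algC -> algC}) (x z : algC) :
  in_Qadj [:: z] x -> nu z = z -> nu x = x.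
Proof.
move=> /in_Qadj1P[p ->] nuz; rewrite -horner_map nuz -map_poly_comp.
by congr _.[_]; apply: eq_map_poly => a /=; rewrite fmorph_rat.
Qed.

(** * Galois theory of cyclotomic fields *)

Lemma Qcyc_gen_prim (n : nat) (z : Qcyc n) :
  (0 < n)%N -> Qcyc_emb n z = zeta n -> n.-primitive_root z.
Proof.
by move=> n_gt0 Dz; rewrite -(fmorph_primitive_root (Qcyc_emb n)) Dz zeta_prim.
Qed.

(** The base [K] is left free: the splitting field axiom takes [1], the Galois property any
    intermediate field. *)
Lemma adjoin_prim_root_splitting (F : fieldType) (L : fieldExtType F)
    (n : nat) (z : L) (K : {subfield L}) :
    n.-primitive_root z -> <<1; z>>%VS = fullv ->
  splittingFieldFor K ('X^n - 1) fullv.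
Proof.
move=> prim_z genz; exists [seq z ^+ i | i <- index_iota 0 n].
  by rewrite big_map (factor_Xn_sub_1 prim_z) eqpxx.
apply/eqP; rewrite eqEsubv subvf -genz /=; apply/FadjoinP; split.
  exact: subv_trans (sub1v K) (subv_adjoin_seq _ _).
(* The remainder keeps the index below n when n = 1. *)
apply: seqv_sub_adjoin; apply/mapP; exists (1 %% n)%N.
  by rewrite mem_index_iota ltn_pmod // (prim_order_gt0 prim_z).
by rewrite (prim_expr_mod prim_z).
Qed.

Lemma Qcyc_splitting (n : nat) :
  (0 < n)%N -> SplittingField.axiom (Qcyc n).
Proof.
move=> n_gt0; have [z Dz genz] := Qadj1_gen (zeta n).
exists ('X^n - 1); first by rewrite rpredB ?rpredX ?polyOverX ?rpred1.
exact: (adjoin_prim_root_splitting 1 (Qcyc_gen_prim n_gt0 Dz) genz).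
Qed.

Lemma adjoin_prim_root_galois (L : splittingFieldType rat) (n : nat) (z : L)
    (K : {subfield L}) :
  n.-primitive_root z -> <<1; z>>%VS = fullv -> galois K {:L}.
Proof.
move=> prim_z genz; apply/splitting_galoisField; exists ('X^n - 1); split.
- by rewrite rpredB ?rpredX ?polyOverX ?rpred1.
- apply: separable_Xn_sub_1; rewrite -(rmorph_nat (in_alg L)) fmorph_eq0.
  by rewrite pnatr_eq0 -lt0n (prim_order_gt0 prim_z).
exact: adjoin_prim_root_splitting prim_z genz.
Qed.

Lemma gal_extend_algC (L : splittingFieldType rat) (f : {rmorphism L -> algC})
    (g : gal_of {:L}) :
  {nu : {rmorphism algC -> algC} | forall x, f (g x) = nu (f x)}.
Proof. by have [nu Dnu] := extend_algC_subfield_aut f g; exists nu. Qed.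

(** Galois descent: Q_n is Galois over Q(w), and each element of its Galois group extends to an
    automorphism of [algC], which by assumption fixes x. *)
Lemma in_Qcyc_fixed (n : nat) (x w : algC) :
    (0 < n)%N -> in_Qadj [:: zeta n] x -> in_Qadj [:: zeta n] w ->
    (forall nu : {rmorphism algC -> algC}, nu w = w -> nu x = x) ->
  in_Qadj [:: w] x.
Proof.
move=> n_gt0 [x' Dx] [w' Dw] fix_x.
have [z Dz genz] := Qadj1_gen (zeta n).
have prim_z := Qcyc_gen_prim n_gt0 Dz.
(* [L] is [Qcyc n] with the splitting structure that Galois groups require. *)
pose Lm := FieldExt_isSplittingField.Build rat (Qcyc n) (Qcyc_splitting n_gt0).
pose L : splittingFieldType rat := HB.pack (Qcyc n) Lm.
pose f : {rmorphism L -> algC} := Qcyc_emb n.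
have galL := @adjoin_prim_root_galois L n z <<1; w'>>%AS prim_z genz.
have : (x' : L) \in <<1; w' : L>>%VS.
  rewrite -(galois_fixedField galL); apply/fixedFieldP; first exact: memvf.
  move=> g Gg; have [nu Dnu] := gal_extend_algC f g.
  apply: (fmorph_inj f); rewrite Dnu /f /= Dx; apply: fix_x.
  rewrite -Dw -[RHS](congr1 f (fixed_gal (subvf _) Gg (memv_adjoin 1 w'))).
  by rewrite Dnu.
case/Fadjoin1_polyP=> p Dx'; apply/in_Qadj1P; exists p.
by rewrite -Dx -Dw -rmorph_horner_rat; congr (Qadj_emb _ _).
Qed.

(** * Divisibility by the conductor *)

Lemma zeta_dvd (d n : nat) :
  (0 < n)%N -> (d %| n)%N -> exists i, zeta d = zeta n ^+ i.
Proof.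
move=> n_gt0 d_n; have d_gt0 := dvdn_gt0 n_gt0 d_n.
have /(prim_rootP (zeta_prim n_gt0))[i ->] : zeta d ^+ n = 1; last by exists i.
by apply/eqP; rewrite -(prim_order_dvd (zeta_prim d_gt0)).
Qed.

Lemma chinese_gcd (c m u : nat) :
    (0 < c)%N -> (0 < u)%N -> coprime u m -> u = 1 %[mod gcdn c m] ->
  exists2 v, coprime v (c * m) & v = 1 %[mod c] /\ v = u %[mod m].
Proof.
move=> c_gt0 u_gt0 co_um /eqP; rewrite eqn_mod_dvd // => /dvdnP[q Dq].
have [k1 k2 Dk _] := egcdnP m c_gt0.
(* Bezout gives k1 c = k2 m + gcd(c, m), and u - 1 = q gcd(c, m), so v = u modulo m. *)
pose v := (k1 * q * c + 1)%N.
have vc : v = 1 %[mod c] by rewrite /v modnMDl.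
have vu : v = u %[mod m].
  rewrite /v mulnAC Dk mulnDl [(gcdn _ _ * q)%N]mulnC -Dq -addnA subnK //.
  by rewrite mulnAC modnMDl.
exists v => //; rewrite coprimeMr -coprime_modl vc coprime_modl coprime1n /=.
by rewrite -coprime_modl vu coprime_modl.
Qed.

(* If nu is z |-> z ^ u on roots of unity and fixes zeta_gcd(c, m), some mu fixes
   zeta_c and agrees with nu on zeta_m.  As alpha lies in Q_c and in Q_m,
   nu alpha = mu alpha = alpha, so alpha lies in Q_gcd(c, m). *)
Lemma conductor_dvdn (alpha : algC) (c m : nat) :
    has_conductor alpha c -> (0 < m)%N -> in_Qadj [:: zeta m] alpha ->
  (c %| m)%N.
Proof.
move=> [[c_gt0 Qalpha] min_c] m_gt0 Qm.
pose g := gcdn c m; have g_gt0 : (0 < g)%N by rewrite gcdn_gt0 c_gt0.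
suff Qg : in_Qadj [:: zeta g] alpha.
  have /min_c le_cg : (0 < g)%N /\
      forall x, in_Qadj [:: alpha] x -> in_Qadj [:: zeta g] x.
    by split=> // x; apply: in_Qadj1_trans.
  suff <- : g = c by apply: dvdn_gcdr.
  by apply/eqP; rewrite eqn_leq le_cg dvdn_leq ?dvdn_gcdl.
have Qc := Qalpha _ (in_Qadj1_id alpha).
apply: (in_Qcyc_fixed c_gt0 Qc).
  have [i ->] := zeta_dvd c_gt0 (dvdn_gcdl c m); apply/in_Qadj1P.
  by exists 'X^i; rewrite map_polyXn hornerXn.
move=> nu nu_g; have cm_gt0 : (0 < c * m)%N by rewrite muln_gt0 c_gt0.
have [u0 co_u0 Du0] := algC_aut_expr nu cm_gt0.
(* Adding c m leaves the action on (c m)-th roots unchanged and makes the exponent positive even if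
   u0 = 0. *)
pose u := (u0 + c * m)%N.
have Du z : z ^+ (c * m) = 1 -> nu z = z ^+ u.
  by move=> z1; rewrite exprD z1 mulr1 Du0.
have zeta1 d : (d %| c * m)%N -> (0 < d)%N -> zeta d ^+ (c * m) = 1.
  move=> d_cm d_gt0; apply/eqP.
  by rewrite -(prim_order_dvd (zeta_prim d_gt0)).
have co_um : coprime u m.
  by rewrite -coprime_modl /u addnC modnMDl coprime_modl;
     move: co_u0; rewrite coprimeMr => /andP[].
have u1 : u = 1 %[mod g].
  apply/eqP; rewrite -(eq_prim_root_expr (zeta_prim g_gt0)) expr1 -Du ?nu_g //.
  by rewrite zeta1 // dvdn_mulr ?dvdn_gcdl.
have u_gt0 : (0 < u)%N by rewrite addn_gt0 cm_gt0 orbT.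
have [v co_v [vc vu]] := chinese_gcd c_gt0 u_gt0 co_um u1.
have [mu Dmu] := Qn_aut_exists co_v.
have mu_c : mu (zeta c) = zeta c.
  rewrite Dmu ?zeta1 ?dvdn_mulr //; apply/eqP.
  by rewrite -[X in _ == X]expr1 (eq_prim_root_expr (zeta_prim c_gt0)) vc.
have mu_m : mu (zeta m) = nu (zeta m).
  rewrite Dmu ?Du ?zeta1 ?dvdn_mull //; apply/eqP.
  by rewrite (eq_prim_root_expr (zeta_prim m_gt0)) vu.
rewrite -[RHS](in_Qadj1_fix Qc mu_c).
move/in_Qadj1P: Qm => [p ->].
rewrite -!horner_map mu_m -!map_poly_comp; congr _.[_].
by apply: eq_map_poly => a /=; rewrite !fmorph_rat.
Qed.

(* Qcyc_emb c is injective, so a is alpha seen in Q_c, and <<1; a>> is the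
   subfield Q(alpha) of Q_c. *)
Theorem theorem3 (alpha : algC) (c : nat) :
  cyclotomic_integer alpha ->
  has_length alpha 2 ->
  has_conductor alpha c ->
  exists2 a : Qcyc c,
    Qcyc_emb c a = alpha & (\dim_(<<1; a>>%VS) {:Qcyc c} <= 2)%N.
Proof.
move=> _ [[e Ue Dalpha] min2] cond_c.
have [[c_gt0 Qalpha] _] := cond_c.
have nz_alpha : alpha != 0.
  apply/eqP=> alpha0; suff /min2 : has_repr_of_weight alpha 0 by [].
  by exists (fun _ => 1) => [[]|]; rewrite ?big_ord0.
have [a Da] := Qalpha _ (in_Qadj1_id alpha); exists a => //.
rewrite big_ord_recl big_ord1 in Dalpha.
set e1 := e ord0 in Dalpha; set e2 := e _ in Dalpha.
have [U1 U2] : Defs.root_of_unity e1 /\ Defs.root_of_unity e2.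
  by split; apply: Ue.
have [n1' n1'_gt0 /unity_rootP/(prim_order_exists n1'_gt0)[n1 prim1 _]] := U1.
have [n2' n2'_gt0 /unity_rootP/(prim_order_exists n2'_gt0)[n2 prim2 _]] := U2.
pose m := lcmn n1 n2.
have m_gt0 : (0 < m)%N.
  by rewrite lcmn_gt0 (prim_order_gt0 prim1) (prim_order_gt0 prim2).
have e1m : e1 ^+ m = 1 by apply/eqP; rewrite -(prim_order_dvd prim1) dvdn_lcml.
have e2m : e2 ^+ m = 1 by apply/eqP; rewrite -(prim_order_dvd prim2) dvdn_lcmr.
have c_m : (c %| m)%N.
  apply: (conductor_dvdn cond_c m_gt0); apply/in_Qadj1P.
  have /(prim_rootP (zeta_prim m_gt0))[i Di] := e1m.
  have /(prim_rootP (zeta_prim m_gt0))[j Dj] := e2m.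
  exists ('X^i + 'X^j).
  by rewrite rmorphD /= !map_polyXn hornerD !hornerXn -Di -Dj.
(* Agreement on e1 and e2 makes the exponents congruent modulo n1 and n2, hence modulo m and its
   divisor c. *)
have agree (mu nu : {rmorphism algC -> algC}) :
    mu e1 = nu e1 -> mu e2 = nu e2 -> mu (zeta c) = nu (zeta c).
  have [u _ Du] := algC_aut_expr mu m_gt0.
  have [v _ Dv] := algC_aut_expr nu m_gt0.
  rewrite (Du e1) // (Du e2) // (Dv e1) // (Dv e2) // => /eqP.
  rewrite (eq_prim_root_expr prim1) => eq1.
  move=> /eqP; rewrite (eq_prim_root_expr prim2) => eq2.
  have zm : zeta c ^+ m = 1.
    by apply/eqP; rewrite -(prim_order_dvd (zeta_prim c_gt0)).
  rewrite Du // Dv //; apply/eqP; rewrite (eq_prim_root_expr (zeta_prim c_gt0)).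
  (* The order makes the truncated difference u - v meaningful. *)
  wlog le_vu : u v {Du Dv} eq1 eq2 / (v <= u)%N => [IH|].
    by case/orP: (leq_total v u) => le; [|rewrite eq_sym]; apply: IH;
       rewrite // eq_sym.
  rewrite eqn_mod_dvd // in eq1; rewrite eqn_mod_dvd // in eq2.
  by rewrite eqn_mod_dvd // (dvdn_trans c_m) // dvdn_lcm eq1.
have aut_root (nu : {rmorphism algC -> algC}) z :
    Defs.root_of_unity z -> Defs.root_of_unity (nu z).
  case=> n n_gt0 /unity_rootP zn1; exists n => //; apply/unity_rootP.
  by rewrite -rmorphXn zn1 rmorph1.
have swap (nu : {rmorphism algC -> algC}) : nu alpha = alpha ->
    (nu e1 = e1 /\ nu e2 = e2) \/ (nu e1 = e2 /\ nu e2 = e1).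
  rewrite Dalpha rmorphD => eq_s; apply: root_of_unity_sum_inj => //.
  - exact: aut_root.
  - exact: aut_root.
  - by rewrite -Dalpha.
have [z Dz genz] := Qadj1_gen (zeta c).
have prim_z := Qcyc_gen_prim c_gt0 Dz.
pose Lm := FieldExt_isSplittingField.Build rat (Qcyc c) (Qcyc_splitting c_gt0).
pose L : splittingFieldType rat := HB.pack (Qcyc c) Lm.
pose f : {rmorphism L -> algC} := Qcyc_emb c.
have galL := @adjoin_prim_root_galois L c z <<1; a>>%AS prim_z genz.
rewrite [X in (X <= 2)%N](galois_dim galL) -card_bool.
pose ext g := sval (gal_extend_algC f g).
have extP (g : gal_of {:L}) x : f (g x) = ext g (f x).
  exact: (svalP (gal_extend_algC f g)).
(* The Galois group is embedded in [bool] by recording whether the chosen extension fixes e1. *)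
rewrite -(card_in_imset (f := fun g => ext g e1 == e1)).
  exact: max_card.
move=> g h Gg Gh /= eq_gh.
have ext_alpha k : k \in 'Gal({:L} / <<1; a : L>>)%g -> ext k alpha = alpha.
  move=> Gk; rewrite -Da.
  rewrite -[RHS](congr1 f (fixed_gal (subvf _) Gk (memv_adjoin 1 a))).
  by rewrite extP.
have [eq1 eq2] : ext g e1 = ext h e1 /\ ext g e2 = ext h e2.
  (* If one fixes and the other swaps, equal booleans force e1 = e2, and the images still agree. *)
  have [[G1 G2] | [G1 G2]] := swap _ (ext_alpha _ Gg);
  have [[H1 H2] | [H1 H2]] := swap _ (ext_alpha _ Gh);
    move: eq_gh; rewrite G1 G2 H1 H2 ?eqxx //.
  - by move/esym/eqP=> ->.
  - by move/eqP=> ->.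
have eq_z : g z = h z.
  by apply: (fmorph_inj f); rewrite !extP /f /= Dz; apply: agree.
apply/eqP/gal_eqP => x _.
have /Fadjoin1_polyP[p ->] : x \in <<1; z : L>>%VS by rewrite genz memvf.
rewrite -!horner_map; congr _.[_]; last exact: eq_z.
by apply/polyP=> i; rewrite !coef_map /= !rmorph_alg.
Qed.
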